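(* For $n\geq 1$ and $\omega\in[0,1)$ let $$p_n(\omega)=\prod_{j=0}^{n-1} 2\sin(\pi\{\omega 2^j\}).$$ There exists a constant $B>0$ such that for Lebesgue almost every $\omega\in[0,1)$ there is a positive integer $n_0(\omega)$ such that for all $n\geq n_0(\omega)$, $$\max\left(p_n(\omega),\,p_n(\omega)^{-1}\right)\leq e^{B\sqrt{n\log\log(n)}}.$$
   Context: Here $\{x\}$ denotes the fractional part of the real number $x$, and $p_n^{-1}(\omega)$ means the reciprocal $1/p_n(\omega)$. *)

(* Defs.v *)
From HB Require Import structures.
From mathcomp Require Import all_boot all_order all_algebra.
From mathcomp Require Import all_classical all_reals all_analysis.

Set Implicit Arguments.
Unset Strict Implicit.
Unset Printing Implicit Defensive.

Import Order.TTheory GRing.Theory Num.Theory.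
Import numFieldNormedType.Exports.

Local Open Scope ring_scope.

Definition frac_part (R : realType) (x : R) : R := x - (Num.floor x)%:~R.

(* For w dyadic, sine_product n w = 0 for large n, and then its
   ring inverse is 0 rather than infinite; such w form a null set. *)
Definition sine_product (R : realType) (n : nat) (w : R) : R :=
  \prod_(0 <= j < n) (2 * sin (pi * frac_part (w * 2 ^+ j))).

(* Main.v *)
Require Import Defs.
From HB Require Import structures.
From mathcomp Require Import all_boot all_order all_algebra.
From mathcomp Require Import all_classical all_reals all_analysis.
From mathcomp Require Import measurable_realfun ring lra.

Set Implicit Arguments.
Unset Strict Implicit.
Unset Printing Implicit Defensive.

Import Order.TTheory GRing.Theory Num.Theory.
Import numFieldNormedType.Exports.

Local Open Scope ring_scope.

(** Write [chord x] for [|2 sin (pi x)|], so that the product is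
    [\prod_(j < n) chord (2 ^ j w)] and has to be compared with 1 on the scale
    [sqrt (n ln ln n)].  The whole argument is an upper half of the law of the
    iterated logarithm for the doubling map [x |-> 2 x mod 1].

    _Martingale structure._  Since
    [chord (2 x) = chord x * chord (x + 1/2)], the function
    [logtan x = ln (chord x) - ln (chord (x + 1/2))], which is [ln |tan (pi x)|],
    equals [2 ln (chord x) - ln (chord (2 x))].  Hence the sum of
    [ln (chord (2 ^ j x))] over [j < n] is the sum of [logtan (2 ^ j x)] up to
    the two boundary terms at times 0 and [n] ([birkhoff_ln_chord]).  As
    [logtan] changes sign under [x |-> x + 1/2], it averages to 0 over the two
    preimages of a point under the doubling map: its Birkhoff sums are sums of
    reversed martingale differences.

    _Exponential moments._  [logtan] is unbounded, and for every [l > 0] the mean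
    of [exp (- l S_n)], where [S_n] is its [n]-th Birkhoff sum, is infinite once
    [n] is large: near the fixed point 0 the singularities of the summands pile
    up.  The function is therefore clipped at height [12 K] when [n] is about
    [2 ^ K]; clipping preserves the sign change.  What controls the conditional
    variances is the function [lyap = chord ^ (-1/2)]: its mean over the two
    preimages of [y] is at most [3/4 lyap y + 1/2] ([lyap_drift]), and it
    dominates [logtan ^ 2] ([sqr_logtan_le]).  Consequently, for [g] a
    small multiple [l] of the clipped function, [1 + k lyap] with [k]
    proportional to [l ^ 2] is an approximate supersolution of the transfer
    operator weighted by [exp g], with growth factor [1 + O(l ^ 2)] per step
    ([weight_drift]).  Stopping the associated supermartingale yields a maximal
    inequality ([unit_int_crosses]).

    _Conclusion._  On the block [n < 2 ^ K] the choice
    [l = sqrt (ln K / 2 ^ K)] makes the probability that some partial sum exceeds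
    a constant multiple of [sqrt (2 ^ K ln K)] at most [O(K ^ -2)]
    ([unit_int_crosses_block]).  The integrability of [lyap] makes the event that
    clipping changes something within the block, or that a boundary term exceeds
    [O(K)], equally unlikely ([unit_int_spiky]).  Both bounds are summable, and
    the Borel-Cantelli lemma gives the theorem. *)

(** * Integration over the unit interval and the doubling map *)

Section unit_integral.
Local Open Scope classical_set_scope.
Local Open Scope ring_scope.
Variable R : realType.
Implicit Types (G H : R -> R) (x y : R).

Definition unit_int G : \bar R :=
  \int[@lebesgue_measure R]_(x in `[0, 1[%classic) (G x)%:E.

Lemma measurable_unit_fun G : measurable_fun [set: R] G ->
  measurable_fun (`[0, 1[%classic : set R) (EFin \o G).
Proof. by move=> mG; apply/measurable_EFinP; exact: measurable_funS mG. Qed.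

Lemma unit_int_ge0 G : (forall x, 0 <= G x) -> (0 <= unit_int G)%E.
Proof. by move=> G0; apply: integral_ge0 => x _; rewrite lee_fin. Qed.

Lemma le_unit_int G H : measurable_fun [set: R] G ->
  measurable_fun [set: R] H -> (forall x, 0 <= G x <= H x) ->
  (unit_int G <= unit_int H)%E.
Proof.
move=> mG mH GH; apply: ge0_le_integral => //.
- by move=> x _; rewrite lee_fin; case/andP: (GH x).
- exact: measurable_unit_fun.
- exact: measurable_unit_fun.
- by move=> x _; rewrite lee_fin; case/andP: (GH x).
Qed.

Lemma unit_intD G H : measurable_fun [set: R] G ->
  measurable_fun [set: R] H -> (forall x, 0 <= G x) -> (forall x, 0 <= H x) ->
  unit_int (fun x => G x + H x) = (unit_int G + unit_int H)%E.
Proof.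
move=> mG mH G0 H0; rewrite /unit_int.
under eq_integral do rewrite EFinD.
apply: ge0_integralD => //.
- by move=> x _; rewrite lee_fin.
- exact: measurable_unit_fun.
- by move=> x _; rewrite lee_fin.
- exact: measurable_unit_fun.
Qed.

Lemma unit_intZ k G : measurable_fun [set: R] G -> 0 <= k ->
  (forall x, 0 <= G x) -> unit_int (fun x => k * G x) = (k%:E * unit_int G)%E.
Proof.
move=> mG k0 G0; rewrite /unit_int.
under eq_integral do rewrite EFinM.
apply: ge0_integralZl_EFin => //.
- by move=> x _; rewrite lee_fin.
- exact: measurable_unit_fun.
Qed.

Lemma unit_int_cst k : unit_int (fun=> k) = k%:E.
Proof.
rewrite /unit_int integral_cst//= lebesgue_measure_itv/= lte01.
by rewrite oppr0 adde0 mule1.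
Qed.

(** For [c = 0] and [c = 1/2] these are the two inverse branches of the doubling
    map. *)
Definition half_shift (c : R) : measurableTypeR R -> measurableTypeR R :=
  fun y => y / 2 + c.

Lemma measurable_half_shift c : measurable_fun setT (half_shift c).
Proof.
have : measurable_fun [set: R] (fun y : R => y / 2 + c).
  by apply: measurable_funD => //; apply: measurable_funM.
exact.
Qed.

Lemma lebesgue_measure_half_shift (c : R) (A : set R) : measurable A ->
  (lebesgue_measure A =
   2^-1%:E * pushforward lebesgue_measure (half_shift c) A)%E.
Proof.
move=> mA.
have h0 : (0 <= 2^-1 :> R) by [].
(* The instance is named because its argument is the measurability proof that
   makes the pushforward a measure. *)
pose nu := mscale (NngNum h0)
  (measure_function_pushforward__canonical__measure_function_Measure
    lebesgue_measure (measurable_half_shift c)).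
rewrite (@lebesgue_measure_unique R nu)// => X [[a b]] _ <-.
rewrite -[RHS]/(2^-1%:E * lebesgue_measure (half_shift c @^-1` `]a, b]))%E /=.
have -> : half_shift c @^-1` `]a, b]%classic =
    `](2 * (a - c)), (2 * (b - c))]%classic.
  apply/seteqP; split => y /=; rewrite /half_shift !in_itv/= => /andP[? ?];
    by apply/andP; split; lra.
rewrite !lebesgue_measure_itv/= !lte_fin.
have -> : (2 * (a - c) < 2 * (b - c)) = (a < b) by lra.
case: ifPn => _; last by rewrite mule0.
by rewrite -!EFinB -EFinM; congr EFin; lra.
Qed.

(** The affine map [half_shift c] has Jacobian [1 / 2]. *)
Lemma integral_half_shift (c : R) G : measurable_fun [set: R] G ->
  (forall x, 0 <= G x) ->
  (\int[@lebesgue_measure R]_(x in `[c, (c + 2^-1)%R[%classic) (G x)%:E =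
   2^-1%:E * unit_int (fun y => G (y / 2 + c)%R))%E.
Proof.
move=> mG G0.
have h0 : (0 <= 2^-1 :> R) by [].
pose nu := mscale (NngNum h0)
  (measure_function_pushforward__canonical__measure_function_Measure
    lebesgue_measure (measurable_half_shift c)).
rewrite (@eq_measure_integral _ _ _ _ nu); last first.
  by move=> A mA _; exact: (lebesgue_measure_half_shift c mA).
have mGE : measurable_fun (`[c, (c + 2^-1)%R[%classic : set R) (EFin \o G).
  by apply/measurable_EFinP; exact: measurable_funS mG.
rewrite /nu ge0_integral_mscale//=; last by move=> x _; rewrite lee_fin.
congr (_ * _)%E.
rewrite (ge0_integral_pushforward (measurable_half_shift c))//=; last first.
  by move=> x _; rewrite lee_fin.
rewrite /unit_int; congr (integral _ _ _).
apply/seteqP; split => y /=; rewrite /half_shift !in_itv/= => /andP[? ?];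
  by apply/andP; split; lra.
Qed.

(** The two inverse branches of the doubling map send the unit interval affinely
    onto its two halves.  Iterating this identity replaces any use of conditional
    expectations: the right-hand integrand is the transfer operator of the
    doubling map applied to [G]. *)
Lemma unit_int_transfer G : measurable_fun [set: R] G -> (forall x, 0 <= G x) ->
  unit_int G = unit_int (fun y => (G (y / 2) + G (y / 2 + 2^-1)) / 2).
Proof.
move=> mG G0.
have mGc c : measurable_fun [set: R] (fun y : R => G (y / 2 + c)).
  apply: measurableT_comp => //.
  by apply: measurable_funD => //; apply: measurable_funM.
transitivity (unit_int (fun y => 2^-1 * (G (y / 2 + 0) + G (y / 2 + 2^-1)))).
  rewrite unit_intZ//; last by move=> x; apply: addr_ge0.
    rewrite unit_intD//.
    rewrite ge0_muleDr ?unit_int_ge0//.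
    rewrite -!integral_half_shift//.
    rewrite -ge0_integral_setU//=.
    - rewrite /unit_int; congr (integral _ _ _).
      apply/seteqP; split => y /=; rewrite !in_itv/=.
        move=> /andP[? ?].
        by have [y2|y2] := ltP y 2^-1; [left|right];
          apply/andP; split; lra.
      by move=> [] /= /andP[? ?]; apply/andP; split; lra.
    - by apply/measurable_EFinP; exact: measurable_funS mG.
    - by move=> x _; rewrite lee_fin.
    - apply/disj_setPS => y [] /=; rewrite !in_itv/= => /andP[? ?] /andP[? ?].
      by lra.
  by apply: measurable_funD; exact: mGc.
by congr unit_int; apply/funext => y; rewrite addr0 mulrC.
Qed.

Lemma unit_int_double G : measurable_fun [set: R] G -> (forall x, 0 <= G x) ->
  periodic G 1 -> unit_int (fun x => G (x * 2)) = unit_int G.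
Proof.
move=> mG G0 G1; rewrite unit_int_transfer//.
  congr unit_int; apply/funext => y.
  have -> : y / 2 * 2 = y by lra.
  have -> : (y / 2 + 2^-1) * 2 = y + 1 by lra.
  by rewrite G1; lra.
apply: measurableT_comp => //.
by apply: measurable_funM.
Qed.

End unit_integral.

(** * A maximal inequality for Birkhoff sums of the doubling map *)

Lemma measurable_bool_natr (R : realType) (P : R -> bool) :
  measurable_fun [set: R] P -> measurable_fun [set: R] (fun x => (P x)%:R : R).
Proof.
move=> mP; rewrite (_ : (fun _ => _) = fun x => if P x then 1 else 0).
  by apply: measurable_fun_ifT => //; exact: measurable_cst.
by apply/funext => x; case: (P x).
Qed.

Section birkhoff.
Local Open Scope classical_set_scope.
Local Open Scope ring_scope.
Variable R : realType.
Implicit Types (g phi : R -> R) (x a c : R) (n N : nat).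

Definition birkhoff g n x := \sum_(j < n) g (x * 2 ^+ j).

Lemma birkhoff0 g x : birkhoff g 0 x = 0.
Proof. by rewrite /birkhoff big_ord0. Qed.

Lemma birkhoffSl g n x : birkhoff g n.+1 x = g x + birkhoff g n (x * 2).
Proof.
rewrite /birkhoff big_ord_recl expr0 mulr1; congr (_ + _).
by apply: eq_bigr => j _; rewrite exprS mulrA.
Qed.

Lemma birkhoffD g m n x :
  birkhoff g (m + n) x = birkhoff g m x + birkhoff g n (x * 2 ^+ m).
Proof.
rewrite /birkhoff big_split_ord/=; congr (_ + _).
by apply: eq_bigr => j _; rewrite exprD mulrA.
Qed.

Lemma birkhoffZ k g n x : birkhoff (fun y => k * g y) n x = k * birkhoff g n x.
Proof. by rewrite /birkhoff mulr_sumr. Qed.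

Lemma periodic_birkhoff g n : periodic g 1 -> periodic (birkhoff g n) 1.
Proof.
move=> g1 x; rewrite /birkhoff; apply: eq_bigr => j _.
rewrite mulrDl mul1r.
have /(_ (2 ^ j)%N) := periodicn g1; rewrite natrX; exact.
Qed.

Lemma measurable_birkhoff g n : measurable_fun [set: R] g ->
  measurable_fun [set: R] (birkhoff g n).
Proof.
move=> mg; apply: measurable_sum => j.
apply: measurableT_comp => //.
by apply: measurable_funM.
Qed.

(** The sums [birkhoff g (N - n) (x * 2 ^+ n)], for [n < N], are the tails of
    [birkhoff g N x]; since the martingale structure is reversed in time, it is
    the tails, and not the initial segments, that obey a maximal inequality. *)
Fixpoint crosses a g N x : bool :=
  if N is N'.+1 then (a <= birkhoff g N x) || crosses a g N' (x * 2)
  else false.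

Lemma crossesN a g N x n : (n < N)%N -> ~~ crosses a g N x ->
  birkhoff g (N - n) (x * 2 ^+ n) < a.
Proof.
elim: N x n => [//|N IH] x [|n] /= nN; rewrite negb_or -ltNge => /andP[lta nc].
  by rewrite subn0 expr0 mulr1.
by rewrite subSS exprS mulrA; exact: IH.
Qed.

Lemma periodic_crosses a g N : periodic g 1 ->
  forall x, crosses a g N (x + 1) = crosses a g N x.
Proof.
move=> g1; elim: N => [//|N IH] x /=.
rewrite periodic_birkhoff//; congr (_ || _).
have -> : (x + 1) * 2 = x * 2 + 1 + 1 by lra.
by rewrite !IH.
Qed.

Lemma measurable_crosses a g N : measurable_fun [set: R] g ->
  measurable_fun [set: R] (crosses a g N).
Proof.
move=> mg; elim: N => [|N IH] /=; first exact: measurable_cst.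
apply: measurable_or; last first.
  apply: (@measurableT_comp _ _ _ _ _ _ _ _ (fun x : R => x * 2)) => //.
  by apply: measurable_funM.
by apply: measurable_fun_ler => //; exact: measurable_birkhoff.
Qed.

(** The supermartingale [phi * exp (birkhoff g)], stopped when a tail first
    reaches the level [a], the tails being explored from the shortest one on. *)
Definition stopped a g (phi : R -> R) N x :=
  if crosses a g N x then expR a else phi x * expR (birkhoff g N x).

Lemma stopped_ge0 a g phi N x : (forall y, 1 <= phi y) ->
  0 <= stopped a g phi N x.
Proof.
move=> phi1; rewrite /stopped; case: ifPn => _; rewrite ?expR_ge0//.
by rewrite mulr_ge0 ?expR_ge0// (le_trans ler01).
Qed.

Lemma measurable_stopped a g phi N : measurable_fun [set: R] g ->
  measurable_fun [set: R] phi -> measurable_fun [set: R] (stopped a g phi N).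
Proof.
move=> mg mphi; apply: measurable_fun_ifT; first exact: measurable_crosses.
  exact: measurable_cst.
apply: measurable_funM => //; apply: measurableT_comp => //.
exact: measurable_birkhoff.
Qed.

(** Unfolding the stopping rule on the side of the longest tail: if that tail is
    the first to reach the level, [phi * exp] is already at least [expR a]. *)
Lemma stoppedS a g phi N x : (forall y, 1 <= phi y) ->
  stopped a g phi N.+1 x <=
    if crosses a g N (x * 2) then expR a
    else phi x * expR (g x) * expR (birkhoff g N (x * 2)).
Proof.
move=> phi1; rewrite /stopped /= -mulrA -expRD -birkhoffSl.
case: (crosses a g N (x * 2)); first by rewrite orbT.
rewrite orbF; case: ifPn => // aS.
rewrite -[X in X <= _]mul1r; apply: ler_pM => //.
by rewrite ?expR_ge0 ?ler_expR.
Qed.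

(** The hypothesis on [phi] says that it is, up to the factor [c], a
    supersolution of the transfer operator weighted by [expR g]; where the process
    has already stopped, a step leaves it unchanged and [1 <= c] is enough. *)
Lemma unit_int_stopped a c g phi N : 1 <= c -> 0 < a ->
  measurable_fun [set: R] g -> measurable_fun [set: R] phi ->
  periodic g 1 -> (forall y, 1 <= phi y) ->
  (forall y, (phi (y / 2) * expR (g (y / 2)) +
     phi (y / 2 + 2^-1) * expR (g (y / 2 + 2^-1))) / 2 <= c * phi y) ->
  (unit_int (stopped a g phi N) <= (c ^+ N)%:E * unit_int phi)%E.
Proof.
move=> c1 a0 mg mphi g1 phi1 Lphi.
have c0 : 0 <= c by apply: le_trans c1.
have phi0 y : 0 <= phi y by apply: le_trans (phi1 y).
elim: N => [|N IH].
  rewrite expr0 mul1e le_eqVlt; apply/orP; left; apply/eqP.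
  by congr unit_int; apply/funext => x; rewrite /stopped/= birkhoff0 expR0 mulr1.
have md : measurable_fun [set: R] (fun x : R => x * 2).
  by apply: measurable_funM.
have mh d : measurable_fun [set: R] (fun x : R => x / 2 + d).
  by apply: measurable_funD => //; apply: measurable_funM.
have mh0 : measurable_fun [set: R] (fun x : R => x / 2).
  by apply: measurable_funM.
(* [G] separates the step at [x] from the process at [2 x]. *)
pose G x := if crosses a g N (x * 2) then expR a
  else phi x * expR (g x) * expR (birkhoff g N (x * 2)).
have mG : measurable_fun [set: R] G.
  apply: measurable_fun_ifT.
  - by apply: (measurableT_comp (measurable_crosses a N mg) md).
  - exact: measurable_cst.
  - apply: measurable_funM; first apply: measurable_funM => //.
      exact: measurableT_comp.
    apply: measurableT_comp => //.
    exact: (measurableT_comp (measurable_birkhoff N mg) md).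
have G0 x : 0 <= G x.
  by rewrite /G; case: ifPn => _; rewrite ?mulr_ge0 ?expR_ge0.
apply: (@le_trans _ _ (unit_int G)).
  apply: le_unit_int => // [|x]; first exact: measurable_stopped.
  by rewrite stopped_ge0//= stoppedS.
rewrite unit_int_transfer//.
apply: (@le_trans _ _ (unit_int (fun y => c * stopped a g phi N y))).
  apply: le_unit_int.
  - apply: measurable_funM => //; apply: measurable_funD.
      exact: (measurableT_comp mG mh0).
    exact: (measurableT_comp mG (mh _)).
  - apply: measurable_funM => //; exact: measurable_stopped.
  - move=> y; rewrite divr_ge0 ?addr_ge0//=.
    have e1 : y / 2 * 2 = y by lra.
    have e2 : (y / 2 + 2^-1) * 2 = y + 1 by lra.
    rewrite /G e1 e2 periodic_crosses// periodic_birkhoff// /stopped.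
    case: ifPn => _.
      have := expR_ge0 a; nra.
    rewrite mulrA -mulrDl mulrAC ler_wpM2r ?expR_ge0//.
rewrite unit_intZ//; last 2 first.
- exact: measurable_stopped.
- by move=> x; exact: stopped_ge0.
by rewrite exprS EFinM -muleA lee_wpmul2l// lee_fin.
Qed.

(** Markov's inequality for the stopped process, whose value on the crossing event
    is exactly [expR a]. *)
Lemma unit_int_crosses a c g phi N : 1 <= c -> 0 < a ->
  measurable_fun [set: R] g -> measurable_fun [set: R] phi ->
  periodic g 1 -> (forall y, 1 <= phi y) ->
  (forall y, (phi (y / 2) * expR (g (y / 2)) +
     phi (y / 2 + 2^-1) * expR (g (y / 2 + 2^-1))) / 2 <= c * phi y) ->
  (unit_int (fun x => (crosses a g N x)%:R) <=
   (c ^+ N * expR (- a))%:E * unit_int phi)%E.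
Proof.
move=> c1 a0 mg mphi g1 phi1 Lphi.
have ms : measurable_fun [set: R] (stopped a g phi N).
  exact: measurable_stopped.
apply: (@le_trans _ _
    (unit_int (fun x => expR (- a) * stopped a g phi N x))).
  apply: le_unit_int => //.
  - by apply: measurable_bool_natr; exact: measurable_crosses.
  - exact: measurable_funM.
  - move=> x; rewrite ler0n /= /stopped; case: (crosses a g N x) => /=.
      by rewrite -expRD addNr expR0.
    by rewrite !mulr_ge0 ?expR_ge0// (le_trans ler01).
rewrite unit_intZ ?expR_ge0//; last by move=> x; exact: stopped_ge0.
rewrite [_ * expR _]mulrC EFinM -muleA lee_wpmul2l ?lee_fin ?expR_ge0//.
exact: unit_int_stopped.
Qed.

End birkhoff.

(** * Almost sure statements from summable integrals *)

Section borel_cantelli.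
Local Open Scope classical_set_scope.
Local Open Scope ring_scope.
Variable R : realType.

(** The bound [2 - 2 / (n + 1)] telescopes, because
    [1 / (k + 1) ^ 2 <= 2 / ((k + 1) (k + 2))]. *)
Lemma sum_inv_sqr_le (n : nat) : \sum_(k < n) (k.+1%:R ^- 2 : R) <= 2.
Proof.
suff : \sum_(k < n) (k.+1%:R ^- 2 : R) <= 2 - 2 / n.+1%:R.
  by move=> /le_trans; apply; rewrite lerBlDr lerDl.
elim: n => [|n IH]; first by rewrite big_ord0 divr1 subrr.
rewrite big_ord_recr /=; apply: (le_trans (lerD IH (lexx _))).
rewrite -subr_ge0.
have -> : 2 - 2 / n.+2%:R - (2 - 2 / n.+1%:R + n.+1%:R ^- 2) =
   n%:R / (n.+1%:R ^+ 2 * n.+2%:R) :> R.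
  rewrite -addn2 -addn1 !natrD.
  have n0 : 0 <= n%:R :> R by [].
  by field; lra.
by rewrite divr_ge0// mulr_ge0// exprn_ge0.
Qed.

(** The Borel-Cantelli lemma.  The exceptional events are given as boolean
    functions, so that their probabilities are integrals of the kind that the
    maximal inequality bounds. *)
Lemma borel_cantelli_unit (P : nat -> R -> bool) (C : R) (k0 : nat) :
  (forall k, measurable_fun [set: R] (P k)) ->
  (forall k, (k0 <= k)%N ->
    (unit_int (fun x => (P k x)%:R) <= (C * k.+1%:R ^- 2)%:E)%E) ->
  {ae @lebesgue_measure R, forall x, x \in `[0, 1[ ->
    exists k1, forall k, (k1 <= k)%N -> ~~ P k x}.
Proof.
move=> mP hP.
pose F k : set (measurableTypeR R) :=
  if (k0 <= k)%N then `[0, 1[ `&` P k @^-1` [set true] else set0.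
have mF k : measurable (F k).
  rewrite /F; case: ifPn => // _.
  have mI : measurable (`[0, 1[ : set (measurableTypeR R)).
    exact: measurable_itv.
  exact: (measurable_funS measurableT (@subsetT _ _) (mP k)).
have C0 : 0 <= C.
  have := hP _ (leqnn k0).
  move=> /(le_trans (unit_int_ge0 _)); rewrite lee_fin => /(_ (fun=> ler0n _ _)).
  by rewrite pmulr_lge0// invr_gt0 exprn_gt0.
have muF k : (lebesgue_measure (F k) <= (C * k.+1%:R ^- 2)%:E)%E.
  rewrite /F; case: ifPn => k0k; last first.
    by rewrite measure0 lee_fin mulr_ge0// invr_ge0 exprn_ge0.
  apply: le_trans (hP _ k0k); rewrite /unit_int.
  have -> : (fun x => ((P k x)%:R)%:E) =
      (fun x => (\1_(P k @^-1` [set true]) x)%:E) :> (R -> \bar R).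
    apply/funext => x; rewrite indicE.
    suff -> : (x \in P k @^-1` [set true]) = P k x by [].
    by apply/idP/idP; rewrite inE.
  rewrite integral_indic//; last first.
    by rewrite -[X in measurable X]setTI; exact: mP.
  by rewrite setIC.
have lim0 : lebesgue_measure (lim_sup_set F) = 0%E.
  apply: lim_sup_set_cvg0 => //.
  apply: (@le_lt_trans _ _ (C * 2)%:E); last exact: ltry.
  apply: lime_le; first by apply: is_cvg_nneseries => k _ _; exact: measure_ge0.
  apply: nearW => n /=.
  apply: (@le_trans _ _ (\sum_(0 <= k < n) (C * k.+1%:R ^- 2)%:E)%E).
    by apply: lee_sum => k _.
  rewrite sumEFin lee_fin -mulr_sumr ler_wpM2l// big_mkord.
  exact: sum_inv_sqr_le.
exists (lim_sup_set F); split => //.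
  by apply: bigcap_measurable => // k _; exact: bigcup_measurable.
move=> x /= nx n _.
apply: contrapT => nFx; apply: nx => x01.
exists (maxn k0 n) => k; rewrite geq_max => /andP[k0k nk].
apply/negP => Pk; apply: nFx; exists k => //=.
by rewrite /F k0k; split.
Qed.

End borel_cantelli.

(** * The chord function and the logarithm of the tangent *)

Section log_tangent.
Local Open Scope classical_set_scope.
Local Open Scope ring_scope.
Variable R : realType.
Implicit Types (x y m k u : R).

(** The distance between 1 and [exp (2 i pi x)] on the unit circle. *)
Definition chord x : R := `|2 * sin (pi * x)|.

Lemma chord_ge0 x : 0 <= chord x. Proof. exact: normr_ge0. Qed.

Lemma chord_le2 x : chord x <= 2.
Proof. by rewrite /chord normrM (@ger0_norm _ 2)// ler_piMr// sin_max. Qed.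

Lemma periodic_chord : periodic chord 1.
Proof. by move=> x; rewrite /chord mulrDr mulr1 sinDpi mulrN normrN. Qed.

Lemma chord_shiftE x : chord (x + 2^-1) = `|2 * cos (pi * x)|.
Proof. by rewrite /chord mulrDr sinDpihalf. Qed.

Lemma chord_double x : chord (x * 2) = chord x * chord (x + 2^-1).
Proof.
rewrite chord_shiftE /chord -normrM; congr `|_|.
have -> : pi * (x * 2) = (pi * x) *+ 2 :> R by rewrite mulrA mulr_natr.
by rewrite sin_mulr2n -mulr_natr; ring.
Qed.

Lemma chord_pythagoras x : chord x ^+ 2 + chord (x + 2^-1) ^+ 2 = 4.
Proof.
rewrite chord_shiftE /chord !real_normK ?num_real//.
by rewrite !exprMn -mulrDr addrC cos2Dsin2; lra.
Qed.

Lemma measurable_chord : measurable_fun [set: R] chord.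
Proof.
apply: measurableT_comp; first exact: normr_measurable.
apply: measurable_funM => //; apply: (@measurableT_comp _ _ _ _ _ _ (@sin R)).
  by apply: continuous_measurable_fun; exact: continuous_sin.
exact: measurable_funM.
Qed.

(** A Lyapunov function for visits to the singularity at the fixed point 0: it
    dominates [(ln chord) ^ 2], is integrable, and the transfer operator contracts
    it up to a constant.  The convention [0^-1 = 0] makes [lyap_double] hold at
    the singularity too. *)
Definition lyap x : R := (Num.sqrt (chord x))^-1.

Lemma lyap_ge0 x : 0 <= lyap x.
Proof. by rewrite invr_ge0 sqrtr_ge0. Qed.

Lemma periodic_lyap : periodic lyap 1.
Proof. by move=> x; rewrite /lyap periodic_chord. Qed.

Lemma measurable_lyap : measurable_fun [set: R] lyap.
Proof.
have -> : lyap = fun x =>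
    if 0 < chord x then expR (- (2^-1 * ln (chord x))) else 0.
  apply/funext => x; rewrite /lyap; case: ifPn => [c0|].
    by rewrite expRN -powR12_sqrt ?chord_ge0// /powR gt_eqF.
  by rewrite -leNgt => c0; rewrite ler0_sqrtr// invr0.
have mc := measurable_chord.
apply: measurable_fun_ifT; last exact: measurable_cst.
  exact: measurable_fun_ltr.
apply: measurableT_comp => //; apply: measurableT_comp => //.
by apply: measurable_funM => //; exact: measurableT_comp.
Qed.

Lemma lyap_double x : lyap (x * 2) = lyap x * lyap (x + 2^-1).
Proof. by rewrite /lyap chord_double sqrtrM ?chord_ge0// invfM. Qed.

Lemma lyap_moderate x : 1 <= chord x -> 2 / 3 <= lyap x <= 1.
Proof.
move=> c1; have s1 : 1 <= Num.sqrt (chord x) by rewrite -sqrtr1 ler_wsqrtr.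
have sN : Num.sqrt (chord x) ^+ 2 = chord x by rewrite sqr_sqrtr ?chord_ge0.
have c2 := chord_le2 x.
have s2 : Num.sqrt (chord x) <= 3 / 2 by nra.
rewrite /lyap invf_le1 ?s1 ?andbT; last lra.
have -> : 2 / 3 = (3 / 2)^-1 :> R by field.
by rewrite lef_pV2// posrE; lra.
Qed.

(** By [chord_pythagoras] one of the two preimages has a chord between 1 and
    2. *)
Lemma lyap_branch x : (2 / 3 <= lyap x <= 1) \/ (2 / 3 <= lyap (x + 2^-1) <= 1).
Proof.
have := chord_pythagoras x; have := chord_ge0 x.
have := chord_ge0 (x + 2^-1) => u0 v0 uv.
have [c1|c1] := leP 1 (chord x); [left|right]; apply: lyap_moderate => //.
by nra.
Qed.

(** The contraction behind the integrability of [lyap].  Of the two preimages,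
    one contributes at most 1 and, by [lyap_double] and the lower bound [2 / 3],
    the other at most [3 / 2] times the value at the image; the truncation at [m]
    respects both bounds. *)
Lemma lyap_drift_min x m : 1 <= m ->
  Num.min (lyap x) m + Num.min (lyap (x + 2^-1)) m <=
  3 / 2 * Num.min (lyap (x * 2)) m + 1.
Proof.
move=> m1; rewrite lyap_double.
have := lyap_ge0 x; have := lyap_ge0 (x + 2^-1).
have [|] := lyap_branch x; set p := lyap x; set q := lyap _;
  move=> /andP[? ?] ? ?;
  rewrite /Num.min; do 3 case: ifPn; rewrite -?leNgt => ? ? ?; nra.
Qed.

Lemma lyap_drift x : lyap x + lyap (x + 2^-1) <= 3 / 2 * lyap (x * 2) + 1.
Proof.
rewrite lyap_double; have := lyap_ge0 x; have := lyap_ge0 (x + 2^-1).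
by have [|] := lyap_branch x => /andP[]; nra.
Qed.

(** With [t = u ^ (1/4)] this is [|ln t| <= 1 / t], a consequence of
    [- ln t <= 1 / t] and of [ln t <= t - 1]. *)
Lemma sqr_ln_le_inv_sqrt u : 0 <= u <= 2 ->
  ln u ^+ 2 <= 16 * (Num.sqrt u)^-1 :> R.
Proof.
move=> /andP[u0 u2]; have [->|un0] := eqVneq u 0.
  by rewrite ln0// expr0n/= mulr_ge0// invr_ge0 sqrtr_ge0.
have {un0}u0 : 0 < u by rewrite lt_neqAle eq_sym un0.
pose t := Num.sqrt (Num.sqrt u).
have t0 : 0 < t by rewrite !sqrtr_gt0.
have t2 : t ^+ 2 = Num.sqrt u by rewrite sqr_sqrtr ?sqrtr_ge0.
have t4 : t ^+ 4 = u by rewrite (exprM t 2 2) t2 sqr_sqrtr// ltW.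
(* [(6 / 5) ^ 4 > 2], and [t (t - 1) <= 1] for [t <= 6 / 5]. *)
have t65 : t <= 6 / 5.
  rewrite leNgt; apply/negP => h; have : (6 / 5) ^+ 4 < t ^+ 4.
    by rewrite ltr_pXn2r// nnegrE; lra.
  by rewrite t4; lra.
have -> : ln u = 4 * ln t by rewrite -t4 lnXn// mulr_natl.
suff lnt : `|ln t| <= t^-1.
  rewrite -t2 -exprVn exprMn -natrX ler_pM2l// -real_normK ?num_real//.
  by rewrite ler_pXn2r ?nnegrE ?normr_ge0 ?invr_ge0 ?(ltW t0).
rewrite ler_norml; apply/andP; split.
  rewrite lerNl -lnV ?posrE//; apply: ltW; apply: ln_sublinear.
  by rewrite invr_gt0.
have lnt1 : ln t <= t - 1.
  have -> : ln t = ln (1 + (t - 1)) by congr ln; lra.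
  by apply: le_ln1Dx; lra.
apply: (le_trans lnt1).
by rewrite -(ler_pM2r t0) mulVf ?gt_eqF//; nra.
Qed.

(** This is [ln |tan (pi x)|] away from the multiples of [1 / 2]; at those
    points, where one chord vanishes, the convention [ln 0 = 0] applies, which
    preserves the sign change under a half-turn. *)
Definition logtan x : R := ln (chord x) - ln (chord (x + 2^-1)).

Lemma alternating_logtan : alternating logtan 2^-1.
Proof.
move=> x; rewrite /logtan -addrA.
have -> : 2^-1 + 2^-1 = 1 :> R by field.
by rewrite periodic_chord opprB.
Qed.

Lemma measurable_logtan : measurable_fun [set: R] logtan.
Proof.
apply: measurable_funB; apply: measurableT_comp => //.
  exact: measurable_chord.
apply: (measurableT_comp measurable_chord).
exact: measurable_funD.
Qed.

Lemma sqr_logtan_le x : logtan x ^+ 2 <= 32 * (lyap x + lyap (x + 2^-1)).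
Proof.
have h z : ln (chord z) ^+ 2 <= 16 * lyap z.
  by apply: sqr_ln_le_inv_sqrt; rewrite chord_ge0 chord_le2.
have := h x; have := h (x + 2^-1); rewrite /logtan.
set a := ln _; set b := ln _.
have := sqr_ge0 (a + b); nra.
Qed.

Definition clipped_logtan m x := if `|logtan x| <= m then logtan x else 0.

Lemma alternating_clipped_logtan m : alternating (clipped_logtan m) 2^-1.
Proof.
move=> x; rewrite /clipped_logtan alternating_logtan normrN.
by case: ifPn; rewrite ?oppr0.
Qed.

Lemma alternating_periodic (f : R -> R) : alternating f 2^-1 -> periodic f 1.
Proof.
move=> fa x.
have -> : x + 1 = x + 2^-1 + 2^-1 by field.
by rewrite !fa opprK.
Qed.

Lemma measurable_clipped_logtan m : measurable_fun [set: R] (clipped_logtan m).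
Proof.
apply: measurable_fun_ifT.
- apply: measurable_fun_ler => //.
  by apply: measurableT_comp => //; exact: measurable_logtan.
- exact: measurable_logtan.
- exact: measurable_cst.
Qed.

Lemma norm_clipped_logtan_le m x : 0 <= m -> `|clipped_logtan m x| <= m.
Proof.
by move=> m0; rewrite /clipped_logtan; case: ifPn => //; rewrite normr0.
Qed.

Lemma sqr_clipped_logtan_le m x :
  clipped_logtan m x ^+ 2 <= 32 * (lyap x + lyap (x + 2^-1)).
Proof.
rewrite /clipped_logtan; case: ifPn => _; first exact: sqr_logtan_le.
by rewrite expr0n/= mulr_ge0// addr_ge0// lyap_ge0.
Qed.

(** Both bounds come from [expR u <= 1 / (1 - u)]. *)
Lemma expR_le_quadratic u : `|u| <= 1 / 10 ->
  expR u <= 1 + u + 2 * u ^+ 2 /\ expR u <= 10 / 9 :> R.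
Proof.
rewrite ler_norml => /andP[ul uu].
have e1 : expR u <= (1 - u)^-1.
  rewrite -[expR u]invrK -expRN lef_pV2 ?posrE ?expR_gt0//; last lra.
  exact: expR_ge1Dx.
have h : (1 - u)^-1 * (1 - u) = 1 by rewrite mulVf//; lra.
have w0 : 0 < (1 - u)^-1 by rewrite invr_gt0; lra.
by split; apply: (le_trans e1); nra.
Qed.

Definition weight k x : R := 1 + k * lyap x.

Lemma weight_ge1 k x : 0 <= k -> 1 <= weight k x.
Proof. by move=> k0; rewrite lerDl mulr_ge0 ?lyap_ge0. Qed.

Lemma measurable_weight k : measurable_fun [set: R] (weight k).
Proof.
apply: measurable_funD => //; apply: measurable_funM => //.
exact: measurable_lyap.
Qed.

(** With [E = expR (g x)], [F = expR (- g x)], [p] and [q] the values of [lyap] at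
    the two preimages and [v = p q] its value at their image, the left-hand side
    is [(E + F) / 2 + k (E p + F q) / 2].  The sign change cancels the linear
    terms, so the first summand is at most [1 + 2 g ^ 2 <= 1 + k (p + q) / 9]; the
    second is at most [5/9 k (p + q)] as [E, F <= 10/9].  Together this is
    [1 + 2/3 k (p + q)], and [p + q <= 3/2 v + 1] by [lyap_drift], whence the
    bound [1 + k v + 2/3 k]. *)
Lemma weight_drift k (g : R -> R) y : 0 <= k -> alternating g 2^-1 ->
  (forall x, `|g x| <= 1 / 10) ->
  (forall x, g x ^+ 2 <= k / 18 * (lyap x + lyap (x + 2^-1))) ->
  (weight k (y / 2) * expR (g (y / 2)) +
   weight k (y / 2 + 2^-1) * expR (g (y / 2 + 2^-1))) / 2 <=
  (1 + 2 / 3 * k) * weight k y.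
Proof.
move=> k0 ga gle g2; rewrite ga.
have -> : weight k y = weight k (y / 2 * 2) by congr weight; field.
move: (y / 2) => x; rewrite /weight.
have /expR_le_quadratic[] := gle x.
have /expR_le_quadratic[] : `|- g x| <= 1 / 10 by rewrite normrN.
have := g2 x; have := lyap_drift x; have := lyap_ge0 x.
have := lyap_ge0 (x + 2^-1); have := lyap_ge0 (x * 2).
rewrite sqrrN.
move: (g x) => u; move: (u ^+ 2) (expR u) (expR (- u)) => G E F.
move: (lyap x) (lyap (x + 2^-1)) (lyap (x * 2)).
move=> p q v v0 q0 p0 drift GL F1 F2 E1 E2.
have kp : 0 <= k * p by exact: mulr_ge0.
have kq : 0 <= k * q by exact: mulr_ge0.
have kpE : k * p * E <= k * p * (10 / 9) by rewrite ler_wpM2l.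
have kqF : k * q * F <= k * q * (10 / 9) by rewrite ler_wpM2l.
have kd : k * (p + q) <= k * (3 / 2 * v + 1) by rewrite ler_wpM2l.
have kkv : 0 <= k * k * v by rewrite !mulr_ge0.
lra.
Qed.

(** The integral [J] of the truncated function is finite, so that
    [J <= 3/4 J + 1/2] can be solved for [J]. *)
Lemma unit_int_min_lyap m : 1 <= m ->
  (unit_int (fun x => Num.min (lyap x) m) <= 2%:E)%E.
Proof.
move=> m1; set G := fun x => _.
have G0 x : 0 <= G x by rewrite /G le_min lyap_ge0 (le_trans ler01).
have mG : measurable_fun [set: R] G.
  by apply: measurable_minr => //; exact: measurable_lyap.
have mh d : measurable_fun [set: R] (fun x : R => x / 2 + d).
  by apply: measurable_funD => //; apply: measurable_funM.
have mh0 : measurable_fun [set: R] (fun x : R => x / 2).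
  by apply: measurable_funM.
have Jle : (unit_int G <= (3 / 4)%:E * unit_int G + (1 / 2)%:E)%E.
  rewrite {1}unit_int_transfer//.
  rewrite -unit_intZ// -[X in (_ <= _ + X)%E]unit_int_cst -unit_intD//.
  - apply: le_unit_int.
    + apply: measurable_funM => //; apply: measurable_funD.
        exact: (measurableT_comp mG mh0).
      exact: (measurableT_comp mG (mh _)).
    + by apply: measurable_funD => //; apply: measurable_funM.
    + move=> y; rewrite divr_ge0 ?addr_ge0//=.
      have := lyap_drift_min (y / 2) m1; rewrite /G.
      have -> : y / 2 * 2 = y by field.
      lra.
  - exact: measurable_funM.
  - by move=> x; exact: mulr_ge0.
have : (unit_int G \is a fin_num).
  rewrite ge0_fin_numE ?unit_int_ge0//.
  apply: (@le_lt_trans _ _ m%:E); last exact: ltry.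
  rewrite -[m%:E]unit_int_cst; apply: le_unit_int => // x.
  by rewrite G0/= /G ge_min lexx orbT.
move: Jle; case: (unit_int G) => // r; rewrite -EFinM -EFinD !lee_fin.
by lra.
Qed.

Lemma unit_int_lyap : (unit_int lyap <= 2%:E)%E.
Proof.
pose g (n : nat) x : \bar R := (Num.min (lyap x) n.+1%:R)%:E.
have glyap x : limn (g^~ x) = (lyap x)%:E.
  apply/cvg_lim => //; apply: cvg_near_cst; near=> n.
  congr EFin; apply/min_idPl.
  have /ltW/le_trans := truncnS_gt (lyap x); apply.
  by rewrite ler_nat ltnS; near: n; exact: nbhs_infty_ge.
have cvg_g : (\int[@lebesgue_measure R]_(x in `[0%R, 1%R[) g n x @[n --> \oo]
    --> unit_int lyap)%E.
  have -> : unit_int lyap =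
      (\int[@lebesgue_measure R]_(x in `[0%R, 1%R[) limn (g^~ x))%E.
    by apply: eq_integral => x _; rewrite glyap.
  apply: cvg_monotone_convergence => //.
  - move=> n; apply: measurable_unit_fun; apply: measurable_minr => //.
    exact: measurable_lyap.
  - by move=> n x _; rewrite lee_fin le_min lyap_ge0/=.
  - move=> x _ m n mn; rewrite lee_fin.
    by rewrite le_min2// ler_nat.
rewrite -(cvg_lim _ cvg_g)//; apply: lime_le.
  by apply/cvg_ex; exists (unit_int lyap).
by apply: nearW => n; apply: unit_int_min_lyap; rewrite ler1n.
Unshelve. all: by end_near.
Qed.

End log_tangent.

(** * Probability estimates at one scale *)

Section blocks.
Local Open Scope classical_set_scope.
Local Open Scope ring_scope.
Variable R : realType.
Implicit Types (x a k l : R) (n N K : nat).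

Lemma unit_int_weight k : 0 <= k -> k <= 1 -> (unit_int (weight k) <= 3%:E)%E.
Proof.
move=> k0 k1; have mlyap := @measurable_lyap R.
rewrite unit_intD//; last 2 first.
- exact: measurable_funM.
- by move=> x; rewrite mulr_ge0 ?lyap_ge0.
rewrite unit_int_cst unit_intZ//; last exact: lyap_ge0.
apply: (@le_trans _ _ (1 + k%:E * 2%:E)%E).
  by rewrite leeD2l// lee_wpmul2l ?unit_int_lyap// lee_fin.
by rewrite -EFinM -EFinD lee_fin; lra.
Qed.

Lemma unit_int_crosses_alternating k a (g : R -> R) N :
  0 <= k -> k <= 1 -> 0 < a -> measurable_fun [set: R] g -> alternating g 2^-1 ->
  (forall x, `|g x| <= 1 / 10) ->
  (forall x, g x ^+ 2 <= k / 18 * (lyap x + lyap (x + 2^-1))) ->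
  (unit_int (fun x => (crosses a g N x)%:R) <=
   (3 * expR (2 / 3 * k * N%:R - a))%:E)%E.
Proof.
move=> k0 k1 a0 mg ga gle g2.
have c1 : 1 <= 1 + 2 / 3 * k by lra.
apply: le_trans (unit_int_crosses N c1 a0 mg (measurable_weight k)
  (alternating_periodic ga) (fun x => weight_ge1 x k0) _) _.
  by move=> y; exact: weight_drift.
apply: (@le_trans _ _ (((1 + 2 / 3 * k) ^+ N * expR (- a))%:E * 3%:E)%E).
  apply: lee_wpmul2l; last exact: unit_int_weight.
  by rewrite lee_fin mulr_ge0 ?expR_ge0// exprn_ge0//; lra.
rewrite -EFinM lee_fin mulrC ler_pM2l// expRD ler_pM2r ?expR_gt0//.
rewrite expRM_natr; apply: lerXn2r; rewrite ?nnegrE ?expR_ge0//; first lra.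
exact: expR_ge1Dx.
Qed.

Lemma unit_int_birkhoff_lyap n :
  (unit_int (birkhoff (@lyap R) n) <= (n%:R * 2)%:E)%E.
Proof.
have mlyap := @measurable_lyap R.
elim: n => [|n IH].
  rewrite (_ : birkhoff _ _ = fun=> 0) ?unit_int_cst ?mul0r//.
  by apply/funext => x; rewrite birkhoff0.
rewrite (_ : birkhoff _ _ = fun x => lyap x + birkhoff (@lyap R) n (x * 2));
  last by apply/funext => x; rewrite birkhoffSl.
have b0 x : 0 <= birkhoff (@lyap R) n x.
  by apply: sumr_ge0 => j _; exact: lyap_ge0.
have mb := measurable_birkhoff n mlyap.
rewrite unit_intD//; last 2 first.
- by apply: (measurableT_comp mb); exact: measurable_funM.
- exact: lyap_ge0.
rewrite unit_int_double//; last by apply/periodic_birkhoff/periodic_lyap.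
rewrite -natr1 mulrDl mul1r addrC EFinD.
by apply: leeD => //; exact: unit_int_lyap.
Qed.

(** This happens as soon as one of the first [2 ^ K + 1] points of the orbit has a
    nonzero chord below [exp (- 4 K)].  Summing [lyap] over the orbit turns the
    union bound into a single application of Markov's inequality. *)
Definition spiky K x : bool :=
  expR (2 * K%:R) < birkhoff (@lyap R) (2 ^ K).+1 x.

Lemma measurable_spiky K : measurable_fun [set: R] (spiky K).
Proof.
apply: measurable_fun_ltr => //.
by apply: measurable_birkhoff; exact: measurable_lyap.
Qed.

Lemma exp2_le_expR K : (2 ^ K)%:R <= expR K%:R :> R.
Proof.
rewrite natrX -[K%:R]mul1r expRM_natr; apply: lerXn2r;
  rewrite ?nnegrE ?expR_ge0//.
by apply: le_trans (expR_ge1Dx 1); lra.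
Qed.

(** The probability is at most [2 (2 ^ K + 1) exp (- 2 K)], of order
    [exp (- K)]. *)
Lemma unit_int_spiky K : (0 < K)%N ->
  (unit_int (fun x => (spiky K x)%:R) <= (8 * K%:R ^- 2)%:E)%E.
Proof.
move=> K0.
have mb : measurable_fun [set: R] (birkhoff (@lyap R) (2 ^ K).+1).
  by apply: measurable_birkhoff; exact: measurable_lyap.
have b0 x : 0 <= birkhoff (@lyap R) (2 ^ K).+1 x.
  by apply: sumr_ge0 => j _; exact: lyap_ge0.
apply: (@le_trans _ _ (unit_int (fun x =>
    expR (- (2 * K%:R)) * birkhoff (@lyap R) (2 ^ K).+1 x))).
  apply: le_unit_int.
  - by apply: measurable_bool_natr; exact: measurable_spiky.
  - exact: measurable_funM.
  - move=> x; rewrite ler0n/= /spiky; case: (ltP (expR _)) => [h|_] /=.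
      by rewrite expRN mulrC ler_pdivlMr ?expR_gt0// mul1r ltW.
    by rewrite mulr_ge0 ?expR_ge0.
rewrite unit_intZ ?expR_ge0//.
apply: (@le_trans _ _ ((expR (- (2 * K%:R)))%:E *
    ((2 ^ K).+1%:R * 2)%:E)%E).
  by rewrite lee_wpmul2l ?unit_int_birkhoff_lyap// lee_fin expR_ge0.
rewrite -EFinM lee_fin.
have e0 : 0 < expR K%:R :> R by exact: expR_gt0.
have -> : expR (- (2 * K%:R)) = (expR K%:R * expR K%:R)^-1 :> R.
  by rewrite -expRD -expRN; congr expR; ring.
have e1 : 1 <= (2 ^ K)%:R :> R by rewrite ler1n expn_gt0.
have e2 := exp2_le_expR K.
have e3 : 1 + K%:R ^+ 2 / 2 <= expR K%:R :> R.
  by have := @expR_ge1Dxn R K%:R 1 (ler0n _ _).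
have K0' : 0 < K%:R :> R by rewrite ltr0n.
rewrite mulrC ler_pdivrMr ?mulr_gt0// mulrAC ler_pdivlMr ?exprn_gt0//.
rewrite -natr1; nra.
Qed.

End blocks.

(** * Pathwise bounds on dyadic blocks *)

Section scales.
Local Open Scope ring_scope.
Variable R : realType.
Implicit Types (x a k l : R) (n N K : nat).

Lemma ln2_ge_half : 1 / 2 <= ln 2 :> R.
Proof.
have h : ln (2^-1) = - ln 2 :> R by rewrite lnV// posrE.
have : ln (1 + - 2^-1) <= - 2^-1 :> R by apply: le_ln1Dx; lra.
have -> : 1 + - 2^-1 = 2^-1 :> R by field.
rewrite h; lra.
Qed.

(** The fourth-order term of the exponential series of [K ln 2], with
    [ln 2 >= 1 / 2], is at least [K ^ 4 / 384]. *)
Lemma cube_le_exp2 (C : R) : exists K0 : nat,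
  forall K, (K0 <= K)%N -> C * K%:R ^+ 3 <= 2 ^+ K.
Proof.
exists (Num.truncn (384 * `|C|)).+1 => K hK.
have CK : 384 * `|C| <= K%:R.
  by apply: (le_trans (ltW (truncnS_gt _))); rewrite ler_nat.
have -> : 2 ^+ K = expR (K%:R * ln 2) :> R.
  by rewrite expRM_natl lnK// posrE.
have K0 : 0 <= K%:R :> R by [].
have x0 : 0 <= K%:R * ln 2 :> R.
  by rewrite mulr_ge0//; have := ln2_ge_half; lra.
apply: le_trans (expR_ge1Dxn 3 x0).
have -> : 4`!%:R = 24 :> R by [].
have le4 : (K%:R * (1 / 2)) ^+ 4 <= (K%:R * ln 2) ^+ 4 :> R.
  have h2 := ln2_ge_half.
  by apply: lerXn2r; rewrite ?nnegrE//; nra.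
have CK3 : C * K%:R ^+ 3 <= `|C| * K%:R ^+ 3.
  by rewrite ler_wpM2r ?exprn_ge0// ler_norm.
have KCK : 384 * `|C| * K%:R ^+ 3 <= K%:R * K%:R ^+ 3.
  by rewrite ler_wpM2r// exprn_ge0.
move: CK3 KCK le4; rewrite exprMn -exprS mulrAC -mulrA.
have -> : (1 / 2) ^+ 4 = 1 / 16 :> R by field.
lra.
Qed.

(** The first inequality keeps the clipped summands, scaled by the slope below,
    under [1 / 10]; the second makes the boundary terms, of order [K],
    negligible. *)
Lemma eventually_scale : exists K0 : nat, forall K, (K0 <= K)%N ->
  [/\ (6 <= K)%N, (120 * K%:R) ^+ 2 * ln K%:R <= 2 ^+ K :> R &
      K%:R ^+ 2 <= ln K%:R * 2 ^+ K :> R].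
Proof.
have [K0 hK0] := cube_le_exp2 (120 ^+ 2).
exists (maxn 6 K0) => K; rewrite geq_max => /andP[K6 /hK0 hK].
have K6' : 6 <= K%:R :> R by rewrite ler_nat.
have lnK : ln K%:R <= K%:R :> R by apply: ltW; apply: ln_sublinear; lra.
have lnK2 : 1 / 2 <= ln K%:R :> R.
  apply: (le_trans ln2_ge_half); rewrite ler_ln ?posrE//; lra.
have K2 : K%:R ^+ 2 * ln K%:R <= K%:R ^+ 3 :> R.
  by rewrite [K%:R ^+ 3]exprSr ler_wpM2l ?exprn_ge0//; lra.
have KK : K%:R ^+ 2 <= K%:R ^+ 3 :> R.
  by rewrite [K%:R ^+ 3]exprSr ler_peMr ?exprn_ge0//; lra.
have T0 : 0 < 2 ^+ K :> R by exact: exprn_gt0.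
split => //.
- by rewrite exprMn -mulrA; apply: le_trans hK; rewrite ler_wpM2l ?exprn_ge0.
- apply: (@le_trans _ _ (1 / 2 * 2 ^+ K)); last by rewrite ler_pM2r.
  by move: hK KK; rewrite expr2; nra.
Qed.

(** The parameter of the exponential moment, which balances its cost
    [slope ^ 2 * 2 ^ K] against the gain [ln K]. *)
Definition block_slope K : R := Num.sqrt (ln K%:R / 2 ^+ K).

(** In units of [ln K], the moment of the block costs [384 = 2/3 * 18 * 32], see
    [weight_drift] and [sqr_clipped_logtan_le]; the excess of 2 yields the summable
    probability [K ^ -2]. *)
Definition block_level K : R := 386 * ln K%:R.

Definition block_fun (s : R) K x : R :=
  s * (block_slope K * clipped_logtan (12 * K%:R) x).

Lemma measurable_block_fun s K : measurable_fun setT (block_fun s K).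
Proof.
apply: measurable_funM => //; apply: measurable_funM => //.
exact: measurable_clipped_logtan.
Qed.

Lemma unit_int_crosses_block s K : s ^+ 2 = 1 -> (6 <= K)%N ->
  (120 * K%:R) ^+ 2 * ln K%:R <= 2 ^+ K :> R ->
  (unit_int (fun x => (crosses (block_level K) (block_fun s K) (2 ^ K) x)%:R)
   <= (3 * K%:R ^- 2)%:E)%E.
Proof.
move=> s1 K6 hK.
have K6' : 6 <= K%:R :> R by rewrite ler_nat.
have ln0 : 0 < ln K%:R :> R by apply: ln_gt0; lra.
have T0 : 0 < 2 ^+ K :> R by exact: exprn_gt0.
pose l := block_slope K.
have l0 : 0 <= l by exact: sqrtr_ge0.
have l2 : l ^+ 2 = ln K%:R / 2 ^+ K.
  by rewrite sqr_sqrtr// divr_ge0// ltW.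
have lT : l ^+ 2 * 2 ^+ K = ln K%:R by rewrite l2 divfK// gt_eqF.
have lK1 : l * (120 * K%:R) <= 1.
  rewrite -(@ler_pXn2r _ 2)// ?nnegrE ?mulr_ge0//.
  by rewrite expr1n exprMn l2 mulrC mulrA ler_pdivrMr// mul1r.
have l1 : l <= 1 / 120 by nra.
have ns : `|s| = 1.
  by apply/eqP; rewrite -sqr_norm_eq1 s1.
(* The factor 32 comes from [sqr_clipped_logtan_le] and 18 from [weight_drift]. *)
pose k : R := 18 * 32 * l ^+ 2.
have k0 : 0 <= k by rewrite mulr_ge0 ?sqr_ge0.
have k1 : k <= 1 by rewrite /k; nra.
have a0 : 0 < block_level K by rewrite /block_level; lra.
apply: le_trans (unit_int_crosses_alternating (2 ^ K) k0 k1 a0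
  (measurable_block_fun s K) _ _ _) _.
- by move=> x; rewrite /block_fun alternating_clipped_logtan; ring.
- move=> x; rewrite /block_fun normrM ns !mul1r normrM (ger0_norm l0).
  apply: (@le_trans _ _ (l * (12 * K%:R))); last by lra.
  by rewrite -/l ler_wpM2l//; apply: norm_clipped_logtan_le; lra.
- move=> x; rewrite /block_fun exprMn s1 mul1r exprMn.
  have -> : k / 18 = l ^+ 2 * 32 by rewrite /k; field.
  by rewrite -/l -mulrA ler_wpM2l ?sqr_ge0// sqr_clipped_logtan_le.
rewrite lee_fin ler_pM2l// natrX.
have -> : 2 / 3 * k * 2 ^+ K - block_level K = - (ln K%:R *+ 2).
  by rewrite /k /block_level -lT -mulr_natr; field.
by rewrite expRN -lnXn ?lnK ?posrE ?exprn_gt0//; lra.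
Qed.

(** Telescoping, since [logtan x = 2 ln (chord x) - ln (chord (2 x))] whenever
    neither chord vanishes. *)
Lemma birkhoff_ln_chord x n : (forall j, chord (x * 2 ^+ j) != 0) ->
  birkhoff (fun y => ln (chord y)) n x =
  birkhoff (@logtan R) n x + ln (chord (x * 2 ^+ n)) - ln (chord x).
Proof.
move=> c0; elim: n => [|n IH].
  by rewrite !birkhoff0 expr0 mulr1 add0r subrr.
rewrite -addn1 !birkhoffD IH /birkhoff !big_ord1 expr0 mulr1 addn1.
rewrite exprSr [x * (_ * 2)]mulrA.
have := c0 n; have := c0 n.+1; rewrite exprSr [x * (_ * 2)]mulrA.
move: (x * 2 ^+ n) => y; rewrite chord_double mulf_eq0 negb_or.
move=> /andP[y0 y1] _.
rewrite /logtan lnM ?posrE ?lt_neqAle 1?eq_sym ?y0 ?y1 ?chord_ge0//.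
lra.
Qed.

Lemma not_spiky_ln_chord x K j : ~~ spiky K x -> (j <= 2 ^ K)%N ->
  chord (x * 2 ^+ j) != 0 -> - (4 * K%:R) <= ln (chord (x * 2 ^+ j)) <= 2.
Proof.
rewrite -leNgt => sp jK c0.
have c1 : 0 < chord (x * 2 ^+ j) by rewrite lt_neqAle eq_sym c0 chord_ge0.
apply/andP; split; last first.
  by apply: (le_trans (ltW (ln_sublinear c1))); exact: chord_le2.
have : lyap (x * 2 ^+ j) <= expR (2 * K%:R).
  apply: le_trans sp; rewrite /birkhoff.
  rewrite (bigD1 (Ordinal (jK : (j < (2 ^ K).+1)%N)))//= lerDl.
  by apply: sumr_ge0 => i _; exact: lyap_ge0.
rewrite /lyap -powR12_sqrt ?chord_ge0// /powR gt_eqF// -expRN ler_expR.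
lra.
Qed.

(** An initial segment is the full sum minus a tail, and both are below the level
    in absolute value; this gives twice the level.  Off the spiky event clipping
    changes nothing within the block, since there
    [2 ln (chord x) - ln (chord (2 x))] is at most [12 K] in absolute value, and
    the boundary terms add at most [6 K]. *)
Lemma block_bound x K n : (6 <= K)%N -> (n < 2 ^ K)%N ->
  (forall j, chord (x * 2 ^+ j) != 0) ->
  ~~ crosses (block_level K) (block_fun 1 K) (2 ^ K) x ->
  ~~ crosses (block_level K) (block_fun (- 1) K) (2 ^ K) x ->
  ~~ spiky K x ->
  block_slope K * `|birkhoff (fun y => ln (chord y)) n x| <=
  2 * block_level K + block_slope K * (6 * K%:R).
Proof.
move=> K6 nK c0 cp cn sp.
have K6' : 6 <= K%:R :> R by rewrite ler_nat.
have clip j : (j < 2 ^ K)%N ->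
    clipped_logtan (12 * K%:R) (x * 2 ^+ j) = logtan (x * 2 ^+ j).
  move=> jK; rewrite /clipped_logtan ifT//.
  have := not_spiky_ln_chord sp (ltnW jK) (c0 j).
  have := not_spiky_ln_chord sp jK (c0 j.+1).
  have := c0 j.+1; rewrite exprSr [x * (_ * 2)]mulrA.
  move: (x * 2 ^+ j) => y; rewrite chord_double mulf_eq0 negb_or.
  move=> /andP[y0 y1].
  rewrite /logtan lnM ?posrE ?lt_neqAle 1?eq_sym ?y0 ?y1 ?chord_ge0//.
  move=> /andP[? ?] /andP[? ?]; rewrite ler_norml; apply/andP; split; lra.
have sum s m y : birkhoff (block_fun s K) m y =
    s * (block_slope K * birkhoff (clipped_logtan (12 * K%:R)) m y).
  by rewrite /block_fun !birkhoffZ.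
have slt s : ~~ crosses (block_level K) (block_fun s K) (2 ^ K) x ->
   birkhoff (block_fun s K) (2 ^ K) x < block_level K /\
   birkhoff (block_fun s K) (2 ^ K) x - birkhoff (block_fun s K) n x
     < block_level K.
  move=> cs; split.
    have := crossesN _ cs => /(_ 0%N); rewrite subn0 expr0 mulr1; apply.
    by rewrite expn_gt0.
  have := crossesN nK cs; rewrite -{2}(subnKC (ltnW nK)) birkhoffD.
  by rewrite addrC addKr.
have Sn : birkhoff (clipped_logtan (12 * K%:R)) n x = birkhoff (@logtan R) n x.
  apply: eq_bigr => j _; apply: clip; exact: ltn_trans (ltn_ord j) nK.
have [] := slt _ cp; have [] := slt _ cn; rewrite !sum Sn birkhoff_ln_chord//.
have /andP[] := not_spiky_ln_chord sp (ltnW nK) (c0 n).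
have := @not_spiky_ln_chord x K 0 sp (leq0n _); have := c0 0%N.
rewrite expr0 mulr1 => c00 /(_ c00)/andP[].
have : 0 <= block_slope K by exact: sqrtr_ge0.
move: (block_slope K) (block_level K) (birkhoff (@logtan R) n x).
move: (birkhoff (clipped_logtan _) _ _) (ln (chord (x * _))) (ln (chord x)).
move=> T u v s a S s0 v1 v2 u1 u2 h1 h2 h3 h4.
have : `|S + u - v| <= `|S| + 6 * K%:R.
  rewrite -addrA; apply: (le_trans (ler_normD _ _)); rewrite lerD2l.
  by rewrite ler_norml; apply/andP; split; lra.
move=> /(ler_wpM2l s0)/le_trans; apply; rewrite mulrDr lerD2r.
rewrite -[X in X * _](ger0_norm s0) -normrM ler_norml.
by apply/andP; split; lra.
Qed.

(** Passing from [K] to [n] loses a factor 2 in [2 ^ K <= 2 n] and another one in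
    [ln K <= 2 ln (ln n)], the latter because [K <= (ln n) ^ 2]. *)
Lemma block_scale_le n K : (6 <= K)%N -> (2 ^ K.-1 <= n)%N ->
  ln K%:R * 2 ^+ K <= 4 * (n%:R * ln (ln n%:R)) :> R.
Proof.
case: K => // K K6 Kn; rewrite /= in Kn.
have K5 : 5 <= K%:R :> R by rewrite ler_nat.
have T0 : 0 < 2 ^+ K :> R by exact: exprn_gt0.
have nT : 2 ^+ K <= n%:R :> R by rewrite -natrX ler_nat.
have lnn : K%:R * ln 2 <= ln n%:R :> R.
  by rewrite mulr_natl -lnXn// ler_ln ?posrE//; apply: lt_le_trans nT.
have h2 := ln2_ge_half.
have lnnK : K%:R / 2 <= ln n%:R :> R.
  apply: le_trans lnn; rewrite ler_wpM2l//; lra.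
have lnn0 : 0 < ln n%:R :> R by lra.
have lnK : ln K.+1%:R <= 2 * ln (ln n%:R) :> R.
  rewrite mulr_natl -lnXn// ler_ln ?posrE ?exprn_gt0//.
  rewrite -natr1; move: (ln n%:R) lnnK => y yK; nra.
have lnK0 : 0 <= ln K.+1%:R :> R by rewrite ln_ge0// ler1n.
rewrite exprS.
have := ler_pM lnK0 (ltW T0) lnK nT; lra.
Qed.

(** The constant is [2 * (2 * 386 + 6)]: with [X = sqrt (2 ^ K ln K)], [block_bound]
    gives [2 * 386 * X + 6 K], where [K <= X], and [X] is at most twice the
    square root in the conclusion. *)
Lemma block_bound_sqrt x K n : (6 <= K)%N -> (2 ^ K.-1 <= n < 2 ^ K)%N ->
  K%:R ^+ 2 <= ln K%:R * 2 ^+ K :> R ->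
  (forall j, chord (x * 2 ^+ j) != 0) ->
  ~~ crosses (block_level K) (block_fun 1 K) (2 ^ K) x ->
  ~~ crosses (block_level K) (block_fun (- 1) K) (2 ^ K) x ->
  ~~ spiky K x ->
  `|birkhoff (fun y => ln (chord y)) n x| <=
  1556 * Num.sqrt (n%:R * ln (ln n%:R)).
Proof.
move=> K6 /andP[Kn nK] hK c0 cp cn sp.
have := block_bound K6 nK c0 cp cn sp.
have K6' : 6 <= K%:R :> R by rewrite ler_nat.
have ln0 : 0 < ln K%:R :> R by apply: ln_gt0; lra.
have T0 : 0 < 2 ^+ K :> R by exact: exprn_gt0.
have l0 : 0 < block_slope K by rewrite sqrtr_gt0 divr_gt0.
pose X : R := Num.sqrt (ln K%:R * 2 ^+ K).
have lX : block_slope K * X = ln K%:R.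
  rewrite /X /block_slope -sqrtrM ?divr_ge0 ?ltW//.
  have -> : ln K%:R / 2 ^+ K * (ln K%:R * 2 ^+ K) = ln K%:R ^+ 2 :> R.
    by rewrite mulrACA [_^-1 * _]mulVf ?gt_eqF// mulr1.
  by rewrite sqrtr_sqr ger0_norm// ltW.
have X2 : X <= 2 * Num.sqrt (n%:R * ln (ln n%:R)).
  have -> : 2 = Num.sqrt (2 ^+ 2) :> R by rewrite sqrtr_sqr ger0_norm.
  rewrite -sqrtrM ?exprn_ge0//; apply: ler_wsqrtr.
  by have := block_scale_le K6 Kn; lra.
have KX : K%:R <= X.
  by rewrite -[K%:R]ger0_norm// -sqrtr_sqr; exact: ler_wsqrtr.
rewrite /block_level -lX => h.
suff : `|birkhoff (fun y => ln (chord y)) n x| <= 2 * 386 * X + 6 * K%:R.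
  lra.
rewrite -(ler_pM2l l0); lra.
Qed.

End scales.

(** * The sine product *)

Section product.
Local Open Scope ring_scope.
Variable R : realType.

Lemma chord_frac_part (x : R) : 0 <= x ->
  2 * sin (pi * frac_part x) = chord x.
Proof.
move=> x0.
have [f0 f1] : 0 <= frac_part x /\ frac_part x < 1.
  have /andP[fl fu] := floor_itv x.
  rewrite /frac_part subr_ge0; split => //.
  by rewrite ltrBlDr addrC -intrD1.
have -> : chord x = chord (frac_part x).
  rewrite -[RHS](periodicn (@periodic_chord R) (absz (Num.floor x))).
  rewrite -[1 *+ _]/((absz (Num.floor x))%:R) natr_absz ger0_norm ?floor_ge0//.
  by rewrite /frac_part subrK.
rewrite /chord ger0_norm// mulr_ge0//; apply: sin_ge0_pi.
by rewrite mulr_ge0 ?pi_ge0//= ler_piMr ?pi_ge0// ltW.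
Qed.

Lemma sine_productE n (w : R) : 0 <= w ->
  sine_product n w = \prod_(j < n) chord (w * 2 ^+ j).
Proof.
move=> w0; rewrite /sine_product big_mkord; apply: eq_bigr => j _.
by rewrite chord_frac_part// mulr_ge0// exprn_ge0.
Qed.

Lemma sine_product_expR n (w : R) : 0 <= w ->
  (forall j, chord (w * 2 ^+ j) != 0) ->
  sine_product n w = expR (birkhoff (fun y => ln (chord y)) n w).
Proof.
move=> w0 c0; rewrite sine_productE// /birkhoff expR_sum.
apply: eq_bigr => j _; rewrite lnK// posrE lt_neqAle eq_sym c0.
exact: chord_ge0.
Qed.

Lemma sine_product_eq0 n j (w : R) : 0 <= w -> (j < n)%N ->
  chord (w * 2 ^+ j) = 0 -> sine_product n w = 0.
Proof.
move=> w0 jn c0; rewrite sine_productE//.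
by rewrite (bigD1 (Ordinal jn))//= c0 mul0r.
Qed.

End product.

Theorem theorem1p1 (R : realType) :
  exists B : R, 0 < B /\
    {ae @lebesgue_measure R, forall w : R, w \in `[0, 1[ ->
      exists n0 : nat, (0 < n0)%N /\
        forall n : nat, (n0 <= n)%N ->
          Num.max (sine_product n w) (sine_product n w)^-1
            <= expR (B * Num.sqrt (n%:R * ln (ln n%:R)))}.
Proof.
exists 1556; split; first lra.
have [K0 scaleK] := eventually_scale R.
have mcross s k : measurable_fun [set: R]
    (crosses (block_level R k.+1) (block_fun s k.+1) (2 ^ k.+1)).
  by apply: measurable_crosses; exact: measurable_block_fun.
have cross_ae s : s ^+ 2 = 1 :> R ->
    {ae @lebesgue_measure R, forall x, x \in `[0, 1[ ->
      exists k1, forall k, (k1 <= k)%N ->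
        ~~ crosses (block_level R k.+1) (block_fun s k.+1) (2 ^ k.+1) x}.
  move=> s1; apply: (@borel_cantelli_unit R _ 3 K0) => // k K0k.
  have [K6 hK _] := scaleK _ (leqW K0k).
  exact: unit_int_crosses_block.
have spiky_ae : {ae @lebesgue_measure R, forall x, x \in `[0, 1[ ->
      exists k1, forall k, (k1 <= k)%N -> ~~ spiky k.+1 x}.
  apply: (@borel_cantelli_unit R _ 8 0) => k; first exact: measurable_spiky.
  by move=> _; exact: unit_int_spiky.
have sN1 : (- 1) ^+ 2 = 1 :> R by rewrite sqrrN expr1n.
have := cross_ae _ (expr1n _ _); have := cross_ae _ sN1; move: spiky_ae.
apply: (filterS3 (F := almost_everywhere (@lebesgue_measure R))).
move=> w spikyw crossN crossP w01.
have w0 : 0 <= w by move: w01; rewrite in_itv/= => /andP[].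
(* At a dyadic point a factor vanishes and so do all later products; with
   [0^-1 = 0] the bound is then trivial. *)
have [[j cj]|c0] := pselect (exists j, chord (w * 2 ^+ j) = 0).
  exists j.+1; split => // n jn.
  by rewrite (sine_product_eq0 w0 jn cj) invr0 maxxx expR_ge0.
have {}c0 j : chord (w * 2 ^+ j) != 0.
  by apply/eqP => cj; apply: c0; exists j.
have [k1 k1P] := spikyw w01; have [k2 k2P] := crossN w01.
have [k3 k3P] := crossP w01.
pose k0 := maxn (maxn k1 k2) (maxn k3 K0).
exists (2 ^ k0)%N; split => [|n kn]; first by rewrite expn_gt0.
have n0 : (0 < n)%N by apply: leq_trans kn; rewrite expn_gt0.
have /andP[nl nu] := trunc_log_bounds (isT : (1 < 2)%N) n0.
pose k := trunc_log 2 n.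
have : (k0 <= k)%N by exact: trunc_log_max.
rewrite !geq_max => /andP[/andP[k1k k2k] /andP[k3k K0k]].
have [K6 _ hK] := scaleK k.+1 (leqW K0k).
have : `|birkhoff (fun y => ln (chord y)) n w| <=
    1556 * Num.sqrt (n%:R * ln (ln n%:R)).
  apply: (block_bound_sqrt (K := k.+1)) => //.
  - by rewrite nl nu.
  - exact: k3P.
  - exact: k2P.
  - exact: k1P.
rewrite sine_product_expR// -expRN ge_max !ler_expR ler_norml.
by move=> /andP[lo ->]; rewrite lerNl lo.
Qed.
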